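(* Let $L\ge 2$ and assume $b_-(\xi_i,\xi_j)\neq 0$ for all $i\ne j$. Let $F_{1\dots L}=\mathcal N_{1\dots L}\,\mathcal F_{1\dots L}\in\mathrm{End}(V_1\otimes\dots\otimes V_L)$, with $\mathcal N_{1\dots L}$ and $\mathcal F_{1\dots L}$ as defined in the context. Then: (i) $F_{1\dots L}$ is lower triangular (in the standard lexicographically ordered basis of $V_1\otimes\dots\otimes V_L$); (ii) $F_{1\dots L}$ is invertible; (iii) for every $\sigma\in S_L$, $$F_{\sigma(1\dots L)}\,R^{\{\sigma\}}_{1\dots L}=F_{1\dots L}.$$
   Context: Weights. Let $\Lambda$ be a set and $a_-,b_\pm,c_\pm:\Lambda\times\Lambda\to\mathbb C$ functions. Let $R(\lambda_1,\lambda_2)\in\mathrm{End}(\mathbb C^2\otimes\mathbb C^2)$ be, in the ordered basis $(e_1\otimes e_1,e_1\otimes e_2,e_2\otimes e_1,e_2\otimes e_2)$, $$R=\begin{pmatrix}1&0&0&0\\0&b_+&c_+&0\\0&c_-&b_-&0\\0&0&0&a_-\end{pmatrix}(\lambda_1,\lambda_2).$$ For labelled copies $V_i\cong\mathbb C^2$, $R_{ij}(\lambda,\lambda')$ denotes $R(\lambda,\lambda')$ acting on $V_i\otimes V_j$ (first tensor factor $=V_i$, second $=V_j$) and trivially elsewhere. Standing assumptions, for all $\lambda_i\in\Lambda$: unitarity $R_{12}(\lambda_1,\lambda_2)R_{21}(\lambda_2,\lambda_1)=I$, and the Yang-Baxter equation $R_{12}(\lambda_1,\lambda_2)R_{13}(\lambda_1,\lambda_3)R_{23}(\lambda_2,\lambda_3)=R_{23}(\lambda_2,\lambda_3)R_{13}(\lambda_1,\lambda_3)R_{12}(\lambda_1,\lambda_2)$.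 Inhomogeneities. Fix $\xi_1,\dots,\xi_L\in\Lambda$, $\xi_i$ attached to $V_i$; write $R_{ij}=R_{ij}(\xi_i,\xi_j)$. $e^{(kl)}_i$ is the $2\times2$ matrix unit (1 in entry $(k,l)$) acting on $V_i$. Definition of $\mathcal F$. $R_{i,(i+1)\dots L}=R_{iL}R_{i(L-1)}\cdots R_{i(i+1)}$; $\mathcal F_{i,(i+1)\dots L}=e^{(11)}_i+e^{(22)}_iR_{i,(i+1)\dots L}$; $\mathcal F_{1\dots L}=\mathcal F_{(L-1),L}\,\mathcal F_{(L-2),(L-1)L}\cdots\mathcal F_{1,2\dots L}$. Definition of $\mathcal N$. By unitarity $a_-(\xi_i,\xi_j)a_-(\xi_j,\xi_i)=1$. Square roots $\sqrt{a_-(\xi_i,\xi_j)}$ ($i\ne j$) are fixed so that $\sqrt{a_-(\xi_i,\xi_j)}\sqrt{a_-(\xi_j,\xi_i)}=1$. $\mathcal N_{ij}$ acts on $V_i\otimes V_j$ as $\mathrm{diag}(1,1,1,1/\sqrt{a_-(\xi_i,\xi_j)})$, and $\mathcal N_{1\dots L}=\prod_{1\le i<j\le L}\mathcal N_{ij}$ (commuting diagonal factors). Relabelling. $\sigma\in S_L$ is identified with the word $\sigma(1\dots L)=(\sigma(1),\dots,\sigma(L))$; $X_{\sigma(1\dots L)}$ denotes the operator on $V_1\otimes\dots\otimes V_L$ obtained from the defining formula of $X_{1\dots L}$ by replacing each label $k$ by $\sigma(k)$, both in the spaces ($V_k\to V_{\sigma(k)}$) and in the inhomogeneities ($\xi_k\to\xi_{\sigma(k)}$).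 Permuted $R$-matrix. Obtain the word $\sigma(1\dots L)$ from $(1,2,\dots,L)$ by a sequence of swaps of adjacent positions. Start with the identity operator; whenever the swap at positions $\alpha,\alpha+1$ is applied to a current word whose entries in those positions are $(x,y)$, multiply on the left by $R_{xy}$. The resulting operator is $R^{\{\sigma\}}_{1\dots L}$; by unitarity and the Yang-Baxter equation it does not depend on the chosen sequence. (E.g. for the word $(2,3,\dots,L,1)$ one gets $R_{1L}\cdots R_{13}R_{12}$.) *)

(* Defs.v *)
From HB Require Import structures.
From mathcomp Require Import all_boot all_order all_algebra all_fingroup.
From mathcomp Require Import mxtens.

Set Implicit Arguments.
Unset Strict Implicit.
Unset Printing Implicit Defensive.

Import GRing.Theory.
Local Open Scope ring_scope.

(* The basis vector of V_0 (x) ... (x) V_(L-1) with index x has e_(d+1) in the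
   factor k, where d = digit x k is the k-th binary digit of x, the most
   significant one first.  The order of the indices in 'I_(2 ^ L) is therefore
   the lexicographic order, and e_1, e_2 have the indices 0, 1 in 'I_2. *)
Definition digit L (x : 'I_(2 ^ L)) (k : 'I_L) : 'I_2 :=
  inZp (x %/ 2 ^ (L - k.+1)).

Section Operators.
Variables (C : fieldType) (L : nat).
Implicit Types (i j : 'I_L) (w : seq 'I_L).

Definition act1 i (A : 'M[C]_2) : 'M[C]_(2 ^ L) :=
  \matrix_(x, y) (A (digit x i) (digit y i) *+
    [forall k, (k != i) ==> (digit x k == digit y k)]).

(* First tensor factor of A in the site i, second one in the site j; only
   meaningful for i != j. *)
Definition act2 i j (A : 'M[C]_(2 * 2)) : 'M[C]_(2 ^ L) :=
  \matrix_(x, y) (A (mxtens_index (digit x i, digit x j))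
                    (mxtens_index (digit y i, digit y j)) *+
    [forall k, (k != i) && (k != j) ==> (digit x k == digit y k)]).

End Operators.

Section Weights.
Variables (C : fieldType) (Lam : Type).

Record weights := Weights {
  a_minus : Lam -> Lam -> C;
  b_plus : Lam -> Lam -> C;
  b_minus : Lam -> Lam -> C;
  c_plus : Lam -> Lam -> C;
  c_minus : Lam -> Lam -> C
}.

Definition Rmatrix (W : weights) (l1 l2 : Lam) : 'M[C]_(2 * 2) :=
  \matrix_(i, j) nth 0 (nth [::]
    [:: [:: 1; 0;              0;               0];
        [:: 0; b_plus W l1 l2;  c_plus W l1 l2;  0];
        [:: 0; c_minus W l1 l2; b_minus W l1 l2; 0];
        [:: 0; 0;              0;               a_minus W l1 l2]] i) j.

Definition unitarity (W : weights) : Prop :=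
  forall l1 l2 : Lam,
    let s1 : 'I_2 := inord 0 in let s2 : 'I_2 := inord 1 in
    act2 s1 s2 (Rmatrix W l1 l2) *m act2 s2 s1 (Rmatrix W l2 l1) = 1%:M.

Definition yang_baxter (W : weights) : Prop :=
  forall l1 l2 l3 : Lam,
    let s1 : 'I_3 := inord 0 in
    let s2 : 'I_3 := inord 1 in
    let s3 : 'I_3 := inord 2 in
    let R12 := act2 s1 s2 (Rmatrix W l1 l2) in
    let R13 := act2 s1 s3 (Rmatrix W l1 l3) in
    let R23 := act2 s2 s3 (Rmatrix W l2 l3) in
    R12 *m R13 *m R23 = R23 *m R13 *m R12.

End Weights.

(* Every operator X_(1...L) is defined for an arbitrary word w of labels, so
   that X_(sigma(1...L)) is its value at the word of sigma. *)
Section FMatrix.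
Variables (C : fieldType) (Lam : Type) (W : weights C Lam).
Variables (L : nat) (xi : 'I_L -> Lam) (sqrt_a : 'I_L -> 'I_L -> C).
Implicit Types (i j : 'I_L) (w : seq 'I_L).

Definition id_word : seq 'I_L := enum 'I_L.
Definition perm_word (s : 'S_L) : seq 'I_L := [seq s k | k <- id_word].

Definition Rop i j : 'M[C]_(2 ^ L) := act2 i j (Rmatrix W (xi i) (xi j)).

(* R_(i, j1...jm) = R_(i jm) ... R_(i j1) *)
Fixpoint Rrow i w : 'M[C]_(2 ^ L) :=
  if w is j :: w' then Rrow i w' *m Rop i j else 1%:M.

Definition calF_row i w : 'M[C]_(2 ^ L) :=
  act1 i (delta_mx 0 0) + act1 i (delta_mx 1 1) *m Rrow i w.

(* F_(i1...im) = F_(i(m-1), im) ... F_(i1, i2...im) *)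
Fixpoint calF w : 'M[C]_(2 ^ L) :=
  match w with
  | [::] | [:: _] => 1%:M
  | i :: w' => calF w' *m calF_row i w'
  end.

Definition calN2 i j : 'M[C]_(2 ^ L) :=
  act2 i j (diag_mx (\row_k nth 0 [:: 1; 1; 1; (sqrt_a i j)^-1] k)).

Fixpoint calN w : 'M[C]_(2 ^ L) :=
  if w is i :: w' then (\prod_(j <- w') calN2 i j) *m calN w' else 1%:M.

Definition Fmatrix w : 'M[C]_(2 ^ L) := calN w *m calF w.

(* permuted_R w M: some sequence of swaps of adjacent positions leads from the
   word 1...L to the word w, with resulting operator M.  Thus R^{s} is any M
   with permuted_R (perm_word s) M; permuted_R_ex below gives one. *)
Inductive permuted_R : seq 'I_L -> 'M[C]_(2 ^ L) -> Prop :=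
| permuted_R_id : permuted_R id_word 1%:M
| permuted_R_swap u x y v M :
    permuted_R (u ++ [:: x, y & v]) M ->
    permuted_R (u ++ [:: y, x & v]) (Rop x y *m M).

Lemma permuted_R_perm_eq u s t M :
  perm_eq s t -> permuted_R (u ++ s) M -> exists M', permuted_R (u ++ t) M'.
Proof.
elim: t u s M => [|x t IH] u s M st.
  by move/perm_nilP: st => ->; exists M.
have xs : x \in s by rewrite (perm_mem st) mem_head.
case/splitPr: xs st => s1 s2 st hM.
have [M' hM'] : exists M', permuted_R (u ++ x :: s1 ++ s2) M'.
  elim/last_ind: s1 s2 M {st} hM => [|s1 z IHs] s2 M; first by exists M.
  rewrite cat_rcons catA => /permuted_R_swap; rewrite -catA => /IHs.
  by rewrite cat_rcons.
have st' : perm_eq (s1 ++ s2) t.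
  by move: st; rewrite -[x :: s2]cat1s perm_catCA /= perm_cons.
have [] := IH (rcons u x) _ M' st'; first by rewrite cat_rcons.
by move=> M2; rewrite cat_rcons; exists M2.
Qed.

Lemma permuted_R_ex (s : 'S_L) : exists M, permuted_R (perm_word s) M.
Proof.
apply: (permuted_R_perm_eq (u := [::]) _ permuted_R_id).
apply: uniq_perm; first exact: enum_uniq.
  by rewrite map_inj_uniq ?enum_uniq //; apply: perm_inj.
move=> k; rewrite mem_enum; apply/esym/mapP; exists (s^-1 k)%g.
  by rewrite mem_enum.
by rewrite permKV.
Qed.

End FMatrix.

(* Main.v *)
From HB Require Import structures.
From mathcomp Require Import all_boot all_order all_algebra all_fingroup.
From mathcomp Require Import mxtens reals complex.
Require Import Defs.

Import GRing.Theory.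
Local Open Scope ring_scope.

Set Implicit Arguments.
Unset Strict Implicit.
Unset Printing Implicit Defensive.

(** Part (iii) reduces to one swap of adjacent letters in an arbitrary word:
    F_(u y x v) R_xy = F_(u x y v).  For empty u, expand both sides over the four
    products of e^(11), e^(22) on the sites x and y; unitarity and the
    Yang-Baxter equation identify them up to the factor a_- on e^(22) e^(22).
    A letter in front of the swap only asks for the Yang-Baxter equation.

    For (i), the e^(22)-rows of R_(i, i+1...L) are lower triangular: reading a
    nonzero matrix element from the site i+1 onwards, the auxiliary site starts
    in e_2, and the first site on which the two indices differ is the one where
    it turns into e_1, so the row index has e_2 there and the column index e_1.
    The diagonal entries are products of values of b_- and a_-, whence (ii). *)

(** * Binary digits of basis indices *)

Lemma divn_digit L (x : 'I_(2 ^ L)) (k : 'I_L) :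
  (x %/ 2 ^ (L - k.+1) = x %/ 2 ^ (L - k) * 2 + digit x k)%N.
Proof.
rewrite {1}(divn_eq (x %/ 2 ^ (L - k.+1)) 2) -divnMA -expnSr.
by rewrite -subSn // subSS.
Qed.

(** The quotient by [2 ^ (L - m)] is the number written by the [m] leading digits. For [m = 0] it
    vanishes because indices are below [2 ^ L]. *)
Lemma divn_eq_digit L (x y : 'I_(2 ^ L)) m : (m <= L)%N ->
  (forall k : 'I_L, (k < m)%N -> digit x k = digit y k) ->
  (x %/ 2 ^ (L - m) = y %/ 2 ^ (L - m))%N.
Proof.
elim: m => [|m IH] ltmL eqxy; first by rewrite subn0 !divn_small.
rewrite !(divn_digit _ (Ordinal ltmL)) eqxy //= IH 1?ltnW // => k ltkm.
by apply: eqxy; apply: ltnW.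
Qed.

Lemma eq_digit L (x y : 'I_(2 ^ L)) : digit x =1 digit y -> x = y.
Proof.
move=> eqxy; apply/val_inj => /=.
have := @divn_eq_digit L x y L (leqnn L); rewrite subnn !divn1; apply.
by move=> k _; apply: eqxy.
Qed.

(** If [y <= x], dividing by [2 ^ (L - k.+1)] keeps the digits up to [k]. Their common leading part
    cancels and [1 <= 0] is left. *)
Lemma ltn_digit L (x y : 'I_(2 ^ L)) (k : 'I_L) :
    (forall l : 'I_L, (l < k)%N -> digit x l = digit y l) ->
  digit x k = 0 -> digit y k = 1 -> (x < y)%N.
Proof.
move=> eqxy xk yk; rewrite ltnNge; apply/negP => /(leq_div2r (2 ^ (L - k.+1))).
rewrite !divn_digit (divn_eq_digit (ltnW (ltn_ord k)) eqxy) xk yk.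
by rewrite leq_add2l.
Qed.

(** An index is determined by its digits, and there are as many indices as digit functions, so the
    injection is a bijection. *)
Lemma digit_surj L (g : 'I_L -> 'I_2) :
  exists x : 'I_(2 ^ L), [forall k, digit x k == g k].
Proof.
have digit_inj : injective (fun x : 'I_(2 ^ L) => [ffun k => digit x k]).
  by move=> x y /ffunP eqxy; apply: eq_digit => k; have := eqxy k; rewrite !ffunE.
have cardE : #|'I_(2 ^ L)| = #|{ffun 'I_L -> 'I_2}|.
  by rewrite card_ffun !card_ord.
have [f _ fK] := inj_card_bij digit_inj (eq_leq (esym cardE)).
exists (f (finfun g)); apply/forallP => k.
by have /ffunP/(_ k) := fK (finfun g); rewrite !ffunE => ->.
Qed.

Definition undigit L (g : 'I_L -> 'I_2) : 'I_(2 ^ L) := xchoose (digit_surj g).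

Lemma undigitK L (g : 'I_L -> 'I_2) : digit (undigit g) =1 g.
Proof. by move=> k; apply/eqP/(forallP (xchooseP (digit_surj g))). Qed.

Lemma digit_eq0or1 (d : 'I_2) : d = 0 \/ d = 1.
Proof. by case: d => [[|[|d]] ltd] //; [left | right]; apply: val_inj. Qed.

(** * Operators supported on a set of sites *)

Section Local.
Variables (C : fieldType) (L : nat).
Implicit Types (S T : {pred 'I_L}) (M N : 'M[C]_(2 ^ L)) (x y z : 'I_(2 ^ L)).

Definition agree S x y := [forall k, (k \in S) ==> (digit x k == digit y k)].

Lemma agreeP S x y :
  reflect (forall k, k \in S -> digit x k = digit y k) (agree S x y).
Proof.
apply: (iffP forallP) => [eqxy k kS | eqxy k]; first exact/eqP/(implyP (eqxy k)).
by apply/implyP => /eqxy ->.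
Qed.

(** [M] is an operator on the sites of [S] tensored with the identity elsewhere: the first clause
    gives the identity, the second says that the entries see only the digits in [S]. *)
Definition local S M : Prop :=
  (forall x y, ~~ agree [predC S] x y -> M x y = 0) /\
  (forall x y x' y', agree [predC S] x y -> agree [predC S] x' y' ->
     agree S x x' -> agree S y y' -> M x y = M x' y').

Lemma local_comm S T M N :
    (forall k, k \in S -> k \notin T) -> local S M -> local T N ->
  GRing.comm M N.
Proof.
move=> disjST.
(* An intermediate index must agree with [x] off [S'] and with [y] off [T']. As the supports are
   disjoint, this leaves a single candidate. *)
have mul1 S' T' M' N' x y : (forall k, k \in S' -> k \notin T') ->
    local S' M' -> local T' N' ->
    let z := undigit (fun k => if k \in S' then digit y k else digit x k) in
    (M' * N') x y = M' x z * N' z y.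
  move=> disj [M0 _] [N0 _] z; rewrite mxE (bigD1 z) //= big1 ?addr0 // => u neq.
  have [/agreeP xu | /M0->] := boolP (agree [predC S'] x u); last by rewrite mul0r.
  have [/agreeP uy | /N0->] := boolP (agree [predC T'] u y); last by rewrite mulr0.
  case/eqP: neq; apply: eq_digit => k; rewrite undigitK.
  by case: ifPn => [/disj kT|kS]; [apply: uy | apply/esym/xu].
move=> locM locN; apply/matrixP => x y.
have disjTS k : k \in T -> k \notin S by apply: contraL; apply: disjST.
rewrite (mul1 S T) // (mul1 T S) //.
set z := undigit _; set z' := undigit _.
have zE k : digit z k = if k \in S then digit y k else digit x k.
  exact: undigitK.
have z'E k : digit z' k = if k \in T then digit y k else digit x k.
  exact: undigitK.
case: locM locN => [M0 Mloc] [N0 Nloc].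
have xz : agree [predC S] x z.
  by apply/agreeP => k; rewrite !inE zE => /negbTE->.
have xz' : agree [predC T] x z'.
  by apply/agreeP => k; rewrite !inE z'E => /negbTE->.
(* If [x] and [y] differ at a site outside both supports, the two products vanish. Otherwise their
   factors agree pairwise by locality. *)
have [zy | zy] := boolP (agree [predC T] z y); last first.
  rewrite N0 // mulr0 M0 ?mulr0 //; apply: contra zy => /agreeP z'y.
  apply/agreeP => k kT; rewrite zE; case: ifPn => // kS.
  by rewrite -z'y // z'E (negbTE kT).
have z'y : agree [predC S] z' y.
  apply/agreeP => k kS; rewrite z'E; case: ifPn => // kT.
  by move/agreeP: zy => <- //; rewrite zE (negbTE kS).
rewrite mulrC; congr (_ * _).
  apply: Nloc => //; apply/agreeP => k kT; first by rewrite zE (negbTE (disjTS _ kT)).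
  by rewrite z'E kT.
apply: Mloc => //; apply/agreeP => k kS; first by rewrite z'E (negbTE (disjST _ kS)).
by rewrite zE kS.
Qed.

Lemma local_act1 i A : local (pred1 i) (@act1 C L i A).
Proof.
split=> [x y|x y x' y' xy xy' /agreeP xx /agreeP yy].
  by rewrite mxE => /negbTE nag; rewrite [[forall _, _]]nag.
by rewrite !mxE [[forall _, _]]xy [[forall _, _]]xy' xx ?inE // yy ?inE.
Qed.

Lemma agree_predC2 i j x y :
  agree [predC pred2 i j] x y =
  [forall k, (k != i) && (k != j) ==> (digit x k == digit y k)].
Proof. by apply: eq_forallb => k; rewrite !inE negb_or. Qed.

Lemma local_act2 i j A : local (pred2 i j) (@act2 C L i j A).
Proof.
split=> [x y|x y x' y'].
  by rewrite agree_predC2 mxE => /negbTE->.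
rewrite !agree_predC2 !mxE => -> -> /agreeP xx /agreeP yy.
by rewrite !xx ?yy ?inE ?eqxx ?orbT.
Qed.

Lemma comm_act1_act2 i j k A B : k != i -> k != j ->
  GRing.comm (@act1 C L k A) (act2 i j B).
Proof.
move=> neki nekj; apply: (local_comm _ (local_act1 _ _) (local_act2 _ _ _)) => l.
by rewrite !inE => /eqP->; rewrite negb_or neki.
Qed.

Lemma comm_act2 i j k l A B : k != i -> k != j -> l != i -> l != j ->
  GRing.comm (@act2 C L k l A) (act2 i j B).
Proof.
move=> neki nekj neli nelj.
apply: (local_comm _ (local_act2 _ _ _) (local_act2 _ _ _)) => m.
by rewrite !inE => /orP[] /eqP->; rewrite negb_or ?neki ?neli.
Qed.

End Local.

(** * Transport of identities from [n] sites to [L] sites *)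

Section Embedding.
Variables (C : fieldType) (n L : nat) (f : 'I_n -> 'I_L).
Hypothesis f_inj : injective f.
Implicit Types (x y z : 'I_(2 ^ L)) (t : 'I_(2 ^ n)).

Definition pull x : 'I_(2 ^ n) := undigit (fun k => digit x (f k)).

Definition push x t : 'I_(2 ^ L) := undigit (fun k =>
  if [pick s | f s == k] is Some s then digit t s else digit x k).

(** [A] acts on the sites in the image of [f], and the identity on the others. Being multiplicative,
    this map carries unitarity and the Yang-Baxter equation from 2 and 3 sites to [L] sites. *)
Definition embed (A : 'M[C]_(2 ^ n)) : 'M[C]_(2 ^ L) :=
  \matrix_(x, y) (A (pull x) (pull y) *+ agree [predC codom f] x y).

Lemma pullE x k : digit (pull x) k = digit x (f k).
Proof. exact: undigitK. Qed.

Lemma pushE x t k : digit (push x t) (f k) = digit t k.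
Proof.
rewrite undigitK; case: pickP => [s /eqP/f_inj-> // | /(_ k)].
by rewrite eqxx.
Qed.

Lemma pushE_out x t k : k \notin codom f -> digit (push x t) k = digit x k.
Proof.
move=> kf; rewrite undigitK; case: pickP => // s /eqP fs.
by rewrite -fs codom_f in kf.
Qed.

Lemma embedM A B : embed (A *m B) = embed A * embed B.
Proof.
apply/matrixP => x y; rewrite !mxE.
rewrite [RHS](bigID (agree [predC codom f] x)) /=.
rewrite [X in _ = _ + X]big1 ?addr0 => [|z]; last first.
  by rewrite !mxE => /negbTE->; rewrite mul0r.
(* The intermediate indices that agree with [x] off the image of [f] are exactly the [push x t],
   which turns the sum into one over [t]. *)
rewrite [RHS](reindex_onto (push x) pull) /= => [|z /agreeP xz]; last first.
  apply: eq_digit => k; have [/codomP[s ->] | kf] := boolP (k \in codom f).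
    by rewrite pushE pullE.
  by rewrite pushE_out // xz.
rewrite -sumrMnl; apply: eq_big => [t | t _].
  apply/esym/andP; split; first by apply/agreeP => k kf; rewrite pushE_out.
  by apply/eqP/eq_digit => k; rewrite pullE pushE.
rewrite !mxE.
have -> : pull (push x t) = t by apply: eq_digit => k; rewrite pullE pushE.
have -> : agree [predC codom f] x (push x t).
  by apply/agreeP => k kf; rewrite pushE_out.
rewrite -mulrnAr; congr (_ * (_ *+ nat_of_bool _)).
by apply/agreeP/agreeP => xy k kf; move: (xy k kf); rewrite pushE_out.
Qed.

Lemma embed1 : embed 1%:M = 1.
Proof.
apply/matrixP => x y; rewrite !mxE -mulrnA mulnb; congr (_ *+ nat_of_bool _).
apply/andP/eqP => [[/eqP exy /agreeP xy] | ->]; last by split => //; apply/agreeP.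
apply: eq_digit => k; have [/codomP[s ->] | kf] := boolP (k \in codom f).
  by rewrite -!pullE exy.
exact: xy.
Qed.

Lemma embed_act2 (s t : 'I_n) A : embed (act2 s t A) = act2 (f s) (f t) A.
Proof.
apply/matrixP => x y; rewrite !mxE !pullE -mulrnA mulnb.
congr (_ *+ nat_of_bool _).
apply/andP/forallP => [[/forallP xy /agreeP xyf] k | xy].
  apply/implyP => /andP[ks kt].
  have [/codomP[r rE] | kf] := boolP (k \in codom f); last by apply/eqP/xyf.
  move/implyP: (xy r); rewrite !pullE -rE; apply.
  by rewrite -!(inj_eq f_inj) -rE ks.
split.
  apply/forallP => r; apply/implyP => /andP[rs rt]; rewrite !pullE.
  by move/implyP: (xy (f r)); apply; rewrite !(inj_eq f_inj) rs.
apply/agreeP => k kf; apply/eqP/(implyP (xy k)).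
by apply/andP; split; apply: contraNneq kf => ->; rewrite codom_f.
Qed.

End Embedding.

(** * The projectors $e^{(11)}_i$ and $e^{(22)}_i$ *)

Section Projectors.
Variables (C : fieldType) (L : nat).
Implicit Types (i j : 'I_L) (M : 'M[C]_(2 ^ L)).

Definition proj i (d : 'I_2) : 'M[C]_(2 ^ L) := act1 i (delta_mx d d).

Lemma proj_diag i d : proj i d = diag_mx (\row_x (digit x i == d)%:R).
Proof.
apply/matrixP => x y; rewrite !mxE -!mulrnA !mulnb; congr (nat_of_bool _)%:R.
apply/andP/andP => [[/andP[xi yi] /forallP xy] | [xi /eqP <-]]; last first.
  by rewrite xi; split=> //; apply/forallP => k; rewrite eqxx implybT.
split=> //; apply/eqP/eq_digit => k; have [-> | neki] := eqVneq k i.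
  by rewrite (eqP xi) (eqP yi).
exact/eqP/(implyP (xy k)).
Qed.

Lemma projE i d x y : proj i d x y = (digit x i == d)%:R *+ (x == y).
Proof. by rewrite proj_diag !mxE. Qed.

Lemma projM i d M x y : (proj i d * M) x y = (digit x i == d)%:R * M x y.
Proof. by rewrite proj_diag [_ * M]mul_diag_mx !mxE. Qed.

Lemma proj_comm i j d e : GRing.comm (proj i d) (proj j e).
Proof. by rewrite !proj_diag; apply: diag_mxC. Qed.

Lemma projK i d : proj i d * proj i d = proj i d.
Proof.
by apply/matrixP => x y; rewrite projM projE; case: eqP; rewrite ?mul1r ?mul0r ?mul0rn.
Qed.

Lemma proj01 i : proj i 1 * proj i 0 = 0.
Proof.
apply/matrixP => x y; rewrite projM projE mxE.
by have [->|->] := digit_eq0or1 (digit x i); rewrite ?mul0rn ?mul0r ?mulr0.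
Qed.

End Projectors.

(** * Rows of the R-matrix, unitarity and the Yang-Baxter equation on [L] sites *)

Section RMatrix.
Variables (C : fieldType) (Lam : Type) (W : weights C Lam).
Variables (L : nat) (xi : 'I_L -> Lam).
Implicit Types (i j k : 'I_L).
Local Notation R := (Rop W xi).

Lemma Rmatrix00 l1 l2 d e :
  Rmatrix W l1 l2 (mxtens_index (0, 0)) (mxtens_index (d, e)) =
  ((d == 0) && (e == 0))%:R.
Proof.
rewrite mxE /=.
by case: (digit_eq0or1 d) => ->; case: (digit_eq0or1 e) => ->.
Qed.

Lemma Rmatrix11 l1 l2 d e :
  Rmatrix W l1 l2 (mxtens_index (1, 1)) (mxtens_index (d, e)) =
  a_minus W l1 l2 * ((d == 1) && (e == 1))%:R.
Proof.
rewrite mxE /=; case: (digit_eq0or1 d) => ->; case: (digit_eq0or1 e) => ->;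
by rewrite ?mulr1 ?mulr0.
Qed.

Lemma Rmatrix10 l1 l2 d e :
  Rmatrix W l1 l2 (mxtens_index (1, 0)) (mxtens_index (d, e)) =
  if d == e then 0 else if d == 1 then b_minus W l1 l2 else c_minus W l1 l2.
Proof.
rewrite mxE /=.
by case: (digit_eq0or1 d) => ->; case: (digit_eq0or1 e) => ->.
Qed.

Lemma Rmatrix01 l1 l2 d e :
  Rmatrix W l1 l2 (mxtens_index (0, 1)) (mxtens_index (d, e)) =
  if d == e then 0 else if d == 1 then c_plus W l1 l2 else b_plus W l1 l2.
Proof.
rewrite mxE /=.
by case: (digit_eq0or1 d) => ->; case: (digit_eq0or1 e) => ->.
Qed.

Lemma RopE i j x y : R i j x y =
  Rmatrix W (xi i) (xi j) (mxtens_index (digit x i, digit x j))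
    (mxtens_index (digit y i, digit y j)) *+ agree [predC pred2 i j] x y.
Proof. by rewrite agree_predC2 /Rop /act2 [LHS]mxE. Qed.

Lemma eq_agree2 i j x y :
  (x == y) = [&& digit x i == digit y i, digit x j == digit y j
               & agree [predC pred2 i j] x y].
Proof.
apply/eqP/and3P => [->|[/eqP xyi /eqP xyj /agreeP xy]].
  by split=> //; apply/agreeP.
apply: eq_digit => k; have [->//|neki] := eqVneq k i.
have [->//|nekj] := eqVneq k j; apply: xy.
by rewrite !inE negb_or neki.
Qed.

Lemma proj00_R i j :
  proj C i 0 * proj C j 0 * R i j = proj C i 0 * proj C j 0.
Proof.
apply/matrixP => x y; rewrite -mulrA !projM RopE projE.
have [xi0|->] := digit_eq0or1 (digit x i); last by rewrite !mul0r.
have [xj0|->] := digit_eq0or1 (digit x j); last by rewrite !mul0r mul0rn.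
rewrite xi0 xj0 Rmatrix00 !mul1r -mulrnA mulnb (eq_agree2 i j) xi0 xj0.
by rewrite eqxx -andbA ![_ == digit y _]eq_sym.
Qed.

(** The only nonzero entry in the last row of the R-matrix is the diagonal one, [a_minus]. This is
    the source of the factor that the normalisation has to absorb. *)
Lemma proj11_R i j :
  proj C i 1 * proj C j 1 * R i j =
  a_minus W (xi i) (xi j) *: (proj C i 1 * proj C j 1).
Proof.
apply/matrixP => x y; rewrite -mulrA !projM [RHS]mxE projM RopE projE.
have [->|xi1] := digit_eq0or1 (digit x i); first by rewrite !mul0r mulr0.
have [->|xj1] := digit_eq0or1 (digit x j); first by rewrite !mul0r mul0rn !mulr0.
rewrite xi1 xj1 Rmatrix11 !mul1r -mulrnAr -mulrnA mulnb (eq_agree2 i j) xi1 xj1.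
by rewrite eqxx -andbA ![_ == digit y _]eq_sym.
Qed.

Lemma R_unitary i j : unitarity W -> i != j -> R i j * R j i = 1.
Proof.
move=> hU neij; pose f (s : 'I_2) := if s == 0 then i else j.
have f_inj : injective f.
  move=> s t; rewrite /f; have [->|->] := digit_eq0or1 s;
  by have [->|->] := digit_eq0or1 t => //= eqij; move: neij; rewrite eqij eqxx.
have := congr1 (embed f) (hU (xi i) (xi j)).
rewrite embedM // !embed_act2 // embed1 /Rop.
have -> : inord 0 = 0 :> 'I_2 by apply: val_inj; rewrite /= inordK.
by have -> : inord 1 = 1 :> 'I_2 by apply: val_inj; rewrite /= inordK.
Qed.

Lemma R_yang_baxter i j k : yang_baxter W -> i != j -> i != k -> j != k ->
  R i j * R i k * R j k = R j k * R i k * R i j.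
Proof.
move=> hYB neij neik nejk.
pose f (s : 'I_3) := nth i [:: i; j; k] s.
have f_inj : injective f.
  move=> s t /eqP; rewrite /f nth_uniq //= => [/eqP/val_inj //|].
  by rewrite !inE negb_or neij neik nejk.
have := congr1 (embed f) (hYB (xi i) (xi j) (xi k)).
by rewrite !embedM // !embed_act2 // /f !inordK.
Qed.

End RMatrix.

(** * Recursion and commutation rules for the factors of F *)

Section Swap.
Variables (C : fieldType) (Lam : Type) (W : weights C Lam).
Variables (L : nat) (xi : 'I_L -> Lam) (sqrt_a : 'I_L -> 'I_L -> C).
Implicit Types (i j k x y : 'I_L) (u v w : seq 'I_L) (A : 'M[C]_(2 ^ L)).
Local Notation R := (Rop W xi).
Local Notation Rrow := (Rrow W xi).
Local Notation calF_row := (calF_row W xi).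
Local Notation calF := (calF W xi).
Local Notation calN2 := (calN2 sqrt_a).
Local Notation calN := (calN sqrt_a).
Local Notation F := (Fmatrix W xi sqrt_a).
Local Notation p := (proj C).

Lemma RrowE i j w : Rrow i (j :: w) = Rrow i w * R i j.
Proof. by []. Qed.

Lemma Rrow_cat i u v : Rrow i (u ++ v) = Rrow i v * Rrow i u.
Proof.
elim: u => [|j u IH]; first by rewrite /= mulr1.
by rewrite cat_cons !RrowE IH mulrA.
Qed.

Lemma calF_rowE i w : calF_row i w = p i 0 + p i 1 * Rrow i w.
Proof. by []. Qed.

Lemma proj0D1 i : p i 0 + p i 1 = 1.
Proof.
apply/matrixP => x y; rewrite mxE !projE mxE -mulrnDl.
by have [->|->] := digit_eq0or1 (digit x i); rewrite ?addr0 ?add0r.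
Qed.

(** This covers the one-letter word too: there the row operator is the sum of the two projectors,
    that is 1. *)
Lemma calF_cons i w : calF (i :: w) = calF w * calF_row i w.
Proof.
by case: w => [|j w] //; rewrite calF_rowE /= mulr1 proj0D1 mulr1.
Qed.

Lemma comm_Rrow A i w :
  (forall j, j \in w -> GRing.comm A (R i j)) -> GRing.comm A (Rrow i w).
Proof.
elim: w => [|j w IH] cA; first exact: commr1.
rewrite RrowE; apply: commrM; last by apply: cA; rewrite mem_head.
by apply: IH => k kw; apply: cA; rewrite inE kw orbT.
Qed.

Lemma comm_calF A w : uniq w ->
    (forall i d, i \in w -> GRing.comm A (p i d)) ->
    (forall i j, i \in w -> j \in w -> GRing.comm A (R i j)) ->
  GRing.comm A (calF w).
Proof.
elim: w => [|i w IH]; first by move=> *; apply: commr1.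
rewrite cons_uniq => /andP[_ uw] cp cR.
rewrite calF_cons calF_rowE; apply: commrM.
  apply: IH => // [j d jw|j k jw kw]; first by apply: cp; rewrite inE jw orbT.
  by apply: cR; rewrite inE ?jw ?kw orbT.
apply: commrD; first by apply: cp; rewrite mem_head.
apply: commrM; first by apply: cp; rewrite mem_head.
by apply: comm_Rrow => j jw; apply: cR; rewrite inE ?eqxx ?jw ?orbT.
Qed.

Lemma comm_R i j k l : k != i -> k != j -> l != i -> l != j ->
  GRing.comm (R k l) (R i j).
Proof. exact: comm_act2. Qed.

Lemma comm_proj_R i j k d : k != i -> k != j -> GRing.comm (p k d) (R i j).
Proof. exact: comm_act1_act2. Qed.

(** In this form, whatever commutes with the two projectors commutes with the normalisation
    factor. *)
Lemma calN2E i j : calN2 i j = 1 + ((sqrt_a i j)^-1 - 1) *: (p i 1 * p j 1).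
Proof.
apply/matrixP => x y.
have one : (1 : 'M[C]_(2 ^ L)) x y = (x == y)%:R by rewrite mxE.
rewrite [RHS]mxE one [X in _ = _ + X]mxE projM projE.
rewrite /calN2 /act2 [LHS]mxE -agree_predC2 !mxE.
rewrite (eq_agree2 i j x y) (inj_eq (can_inj (@mxtens_indexK 2 2))) xpair_eqE.
set ag := agree _ _ _.
have [->|->] := digit_eq0or1 (digit x i);
have [->|->] := digit_eq0or1 (digit x j);
have [->|->] := digit_eq0or1 (digit y i);
have [->|->] := digit_eq0or1 (digit y j);
by case: ag; rewrite //= ?(mulr0n, mulr1n, mul0r, mulr0, mul1r, mulr1, addr0, add0r) // addrC subrK.
Qed.

Lemma comm_calN2 A i j :
  GRing.comm A (p i 1) -> GRing.comm A (p j 1) -> GRing.comm A (calN2 i j).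
Proof.
move=> ci cj; rewrite calN2E; apply: commrD; first exact: commr1.
have cij : A *m (p i 1 * p j 1) = (p i 1 * p j 1) *m A by apply: commrM.
by rewrite /GRing.comm -[LHS]scalemxAr -[RHS]scalemxAl cij.
Qed.

Lemma calN_cons i w : calN (i :: w) = \prod_(j <- w) calN2 i j * calN w.
Proof. by []. Qed.

Lemma comm_calN A w :
  (forall i, i \in w -> GRing.comm A (p i 1)) -> GRing.comm A (calN w).
Proof.
elim: w => [|i w IH] cA; first exact: commr1.
apply: commrM; last by apply: IH => j jw; apply: cA; rewrite inE jw orbT.
rewrite big_seq; apply: commr_prod => j jw.
by apply: comm_calN2; apply: cA; rewrite inE ?eqxx ?jw ?orbT.
Qed.

Lemma calN2_comm i j k l : GRing.comm (calN2 i j) (calN2 k l).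
Proof.
by apply: comm_calN2; apply/commr_sym/comm_calN2; apply: proj_comm.
Qed.

(** * Exchange of two adjacent letters *)

Hypothesis (hYB : yang_baxter W) (hU : unitarity W).

(** The exchange relation for two rows over the same sites, of RTT type. By induction on [v]:
    factors without a common site commute, so the Yang-Baxter equation for [x], [y] and the first
    letter of [v] can be applied. *)
Lemma Rrow_yang_baxter x y v : uniq [:: x, y & v] ->
  Rrow y v * Rrow x v * R x y = R x y * (Rrow x v * Rrow y v).
Proof.
elim: v => [|z v IH]; first by rewrite /= !mul1r !mulr1.
move=> uniq_xyzv; rewrite !RrowE; have := uniq_xyzv.
rewrite /= !inE !negb_or => /and4P[/and3P[xy xz xv] /andP[yz yv] zv uv].
have {}IH : Rrow y v * Rrow x v * R x y = R x y * (Rrow x v * Rrow y v).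
  by apply: IH; rewrite /= inE negb_or xy xv yv.
have cRyz : Rrow x v * R y z = R y z * Rrow x v.
  apply/commr_sym/comm_Rrow => t tv; apply: comm_R; rewrite ?[_ == x]eq_sym //.
    by apply: contraNneq yv => ->.
  by apply: contraNneq zv => ->.
have cRxz : Rrow y v * R x z = R x z * Rrow y v.
  apply/commr_sym/comm_Rrow => t tv; apply: comm_R; rewrite ?[_ == y]eq_sym //.
  - by rewrite eq_sym.
  - by apply: contraNneq xv => ->.
  - by apply: contraNneq zv => ->.
have yb := R_yang_baxter xi hYB xy xz yz.
transitivity (Rrow y v * Rrow x v * (R y z * R x z * R x y)).
  by rewrite -!mulrA; congr (_ * _); rewrite !mulrA cRyz.
rewrite -yb !mulrA IH.
by rewrite -!mulrA; do 2 congr (_ * _); rewrite !mulrA cRxz.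
Qed.

(** [R x y] commutes with the projectors on [i] and with the parts of the row over [u] and [v]. Only
    the factors [R i x] and [R i y] are left, for which this is the Yang-Baxter equation. *)
Lemma calF_row_swap i u x y v : uniq (i :: u ++ [:: x, y & v]) ->
  calF_row i (u ++ [:: y, x & v]) * R x y =
  R x y * calF_row i (u ++ [:: x, y & v]).
Proof.
rewrite cons_uniq cat_uniq mem_cat !inE !negb_or -!andbA cons_uniq cons_uniq.
rewrite inE negb_or -!andbA.
case/and5P => iu ix iy iv /and5P[uu xu yu uv /and4P[xy xv yv _]].
have cR w : x \notin w -> y \notin w -> R x y * Rrow i w = Rrow i w * R x y.
  move=> xw yw; apply: comm_Rrow => j jw; apply: comm_R; rewrite 1?eq_sym //.
    by apply: contraNneq xw => <-.
  by apply: contraNneq yw => <-.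
rewrite !calF_rowE mulrDl mulrDr !Rrow_cat !RrowE.
have cp d : R x y * p i d = p i d * R x y.
  by apply/commr_sym/comm_proj_R.
rewrite cp; congr (_ + _); rewrite [RHS]mulrA cp -!mulrA; congr (_ * _).
rewrite -(cR u) // [RHS]mulrA (cR v) // -!mulrA; congr (_ * _); rewrite !mulrA.
by rewrite R_yang_baxter.
Qed.

(* The two operators differ only where x and y both carry e_2, by the factor
   a_-; the normalisation N absorbs it because a_- / sqrt a_xy = 1 / sqrt a_yx. *)
Lemma calF_swap x y v (Q := Rrow x v * Rrow y v) (E := p x 1 * p y 1)
    (B := p y 0 * p x 0 + p y 0 * p x 1 * (Rrow x v * R x y)
          + p x 0 * p y 1 * Rrow y v) :
  uniq [:: x, y & v] ->
  calF [:: x, y & v] = calF v * (B + a_minus W (xi x) (xi y) *: (E * Q)) /\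
  calF [:: y, x & v] * R x y = calF v * (B + E * Q).
Proof.
move=> uxyv; have := uxyv; rewrite !cons_uniq inE negb_or.
case/and3P => /andP[xy xv] yv uv.
have yx : y != x by rewrite eq_sym.
have cp a b d : a != b -> a \notin v -> GRing.comm (p a d) (Rrow b v).
  move=> ab av; apply: comm_Rrow => j jv; apply: comm_proj_R => //.
  by apply: contraNneq av => ->.
have Ryx : R y x * R x y = 1 by apply: R_unitary.
rewrite !calF_cons !calF_rowE !RrowE; split.
  have e1 : p y 1 * Rrow y v * p x 0 = p x 0 * p y 1 * Rrow y v.
    by rewrite -mulrA -cp // mulrA proj_comm.
  (* The exchange relation brings [R x y] next to [E], where it becomes the scalar [a_minus]. *)
  have e2 : p y 1 * Rrow y v * (p x 1 * (Rrow x v * R x y)) =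
            a_minus W (xi x) (xi y) *: (E * Q).
    rewrite mulrA -(mulrA (p y 1)) -cp // (mulrA (p y 1)) proj_comm -/E.
    rewrite -mulrA (mulrA (Rrow y v)) Rrow_yang_baxter // mulrA.
    by rewrite proj11_R -[LHS]scalemxAl.
  rewrite -(mulrA (calF v)); congr (_ * _).
  by rewrite mulrDl !mulrDr e1 e2 mulrA -!addrA.
have f2 : p x 0 * (p y 1 * (Rrow y v * R y x)) * R x y = p x 0 * p y 1 * Rrow y v.
  by rewrite -!mulrA Ryx mulr1.
have f3 : p x 1 * Rrow x v * p y 0 * R x y = p y 0 * p x 1 * (Rrow x v * R x y).
  by rewrite -(mulrA (p x 1)) -cp // !mulrA [p x 1 * _]proj_comm.
(* Here [R y x] and [R x y] cancel by unitarity, so no scalar appears. *)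
have f4 : p x 1 * Rrow x v * (p y 1 * (Rrow y v * R y x)) * R x y = E * Q.
  rewrite -!mulrA Ryx mulr1 (mulrA (Rrow x v)) -cp //.
  by rewrite -!mulrA.
rewrite -!(mulrA (calF v)); congr (_ * _).
rewrite mulrDl !mulrDr !mulrDl f2 f3 f4 proj00_R [p x 0 * _]proj_comm.
by rewrite -/B !addrA; congr (_ + _); rewrite addrAC.
Qed.

(** [E] is idempotent, so the factor fixes what [E] kills and multiplies the range of [E] by the
    inverse root. *)
Lemma calN2_mul i j c A B : let E := p i 1 * p j 1 in E * A = 0 ->
  calN2 i j * (A + c *: (E * B)) = A + ((sqrt_a i j)^-1 * c) *: (E * B).
Proof.
move=> E EA; rewrite calN2E mulrDl mul1r -[X in _ + X]scalemxAl.
have EE : E * E = E.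
  rewrite /E -mulrA (mulrA (p j 1)) (proj_comm C j) !mulrA projK.
  by rewrite -mulrA projK.
rewrite mulmxDr [E *m A]EA add0r -scalemxAr [E *m _]mulrA EE -addrA scalerA.
by rewrite -scalerDl mulrBl mul1r [c + _]addrC subrK.
Qed.

Hypothesis (hsqrt : forall i j, i != j -> sqrt_a i j ^+ 2 = a_minus W (xi i) (xi j)).
Hypothesis (hsqrtV : forall i j, i != j -> sqrt_a i j * sqrt_a j i = 1).

Lemma Fmatrix_swap u x y v : uniq (u ++ [:: x, y & v]) ->
  F (u ++ [:: y, x & v]) * R x y = F (u ++ [:: x, y & v]).
Proof.
elim: u => [|i u IH].
  rewrite !cat0s => uxyv; have := uxyv; rewrite !cons_uniq inE negb_or.
  case/and3P => /andP[xy xv] yv uv; have [Fxy Fyx] := calF_swap uxyv.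
  set B := (p y 0 * p x 0 + _ + _) in Fxy Fyx.
  pose E := p x 1 * p y 1.
  (* Each term of [B] contains a projector onto e_1 at [x] or [y], and [E] projects both sites onto
     e_2. *)
  have EB : E * B = 0.
    have Ey : E * p y 0 = 0 by rewrite /E -mulrA proj01 mulr0.
    have Ex : E * p x 0 = 0 by rewrite /E (proj_comm C x) -mulrA proj01 mulr0.
    clearbody E; rewrite !mulrDr !mulrA Ex Ey.
    by rewrite !(mulr0, mul0r) !addr0.
  (* The normalisation factors common to both words. Only [calN2 x y] and [calN2 y x] distinguish
     the two sides, and they commute past [M] and [calF v]. *)
  pose M := \prod_(j <- v) calN2 x j * \prod_(j <- v) calN2 y j * calN v.
  have NM a b : calN2 a b * M = M * calN2 a b.
    have c2 : GRing.comm (calN2 a b) (calN v).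
      apply: comm_calN => j _.
      by apply/commr_sym/comm_calN2; apply: proj_comm.
    apply: commrM c2; apply: commrM; apply: commr_prod => j _; exact: calN2_comm.
  have Nxy : calN [:: x, y & v] = calN2 x y * M.
    by rewrite !calN_cons big_cons /M -!mulrA.
  have Nyx : calN [:: y, x & v] = calN2 y x * M.
    rewrite !calN_cons big_cons /M -!mulrA; congr (_ * _); rewrite !mulrA.
    congr (_ * _); apply: commr_prod => j _; apply/commr_sym.
    by apply: commr_prod => k _; apply: calN2_comm.
  have NF a b : a \notin v -> b \notin v -> calN2 a b * calF v = calF v * calN2 a b.
    move=> av bv; apply: comm_calF => // [j d jv|j k jv kv].
      by apply/commr_sym/comm_calN2; apply: proj_comm.
    apply/commr_sym/comm_calN2; apply/commr_sym/comm_proj_R;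
      by [apply: contraNneq av => -> | apply: contraNneq bv => ->].
  have s_neq0 a b : a != b -> sqrt_a a b != 0.
    move/hsqrtV => sab; apply: contra_eq_neq sab => ->.
    by rewrite mul0r eq_sym oner_eq0.
  have yx : y != x by rewrite eq_sym.
  rewrite /Fmatrix !mulmxE -mulrA Fyx Fxy Nxy Nyx !NM.
  rewrite -!(mulrA M); congr (_ * _).
  rewrite !(mulrA (calN2 _ _) (calF v)) !NF // -!(mulrA (calF v)); congr (_ * _).
  rewrite -[X in _ * (B + X) = _]scale1r (calN2_mul _ _ EB).
  have EB' : p y 1 * p x 1 * B = 0 by rewrite (proj_comm C y).
  rewrite (proj_comm C x y) (calN2_mul _ _ EB'); congr (_ + _ *: _).
  (* It remains to compare the scalars on [E * Q]: with [a_minus] the square of [sqrt_a x y], both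
     equal [sqrt_a x y]. *)
  rewrite mulr1 -(hsqrt xy) expr2 mulKf ?s_neq0 //.
  by apply: (mulIf (s_neq0 _ _ yx)); rewrite mulVf ?s_neq0 // hsqrtV.
rewrite !cat_cons => uxyv; have := uxyv; rewrite cons_uniq => /andP[_ uniqw].
have {IH}Fw := IH uniqw.
have FE w : F (i :: w) = \prod_(j <- w) calN2 i j * F w * calF_row i w.
  by rewrite /Fmatrix !mulmxE calF_cons calN_cons !mulrA.
rewrite !FE -mulrA calF_row_swap // -Fw !mulrA; do 3 congr (_ * _).
rewrite !big_cat !big_cons /= -!mulrA; congr (_ * _); rewrite !mulrA.
by rewrite calN2_comm.
Qed.

Lemma Fmatrix_permuted_R w M : permuted_R W xi w M ->
  F w * M = F (id_word L).
Proof.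
(* The induction also carries [perm_eq], which keeps every intermediate word free of repetitions, as
   the swap lemma requires. *)
move=> wM; suff [] : perm_eq (id_word L) w /\ F w * M = F (id_word L) by [].
elim: wM => [|u x y v {}M _ [pw FM]]; first by rewrite mulr1.
have uw : uniq (u ++ [:: x, y & v]) by rewrite -(perm_uniq pw) enum_uniq.
split; last by rewrite mulmxE mulrA Fmatrix_swap.
by rewrite (perm_trans pw) // perm_cat2l; apply/seq.permP => a /=; rewrite addnCA.
Qed.

End Swap.

(** * Lower triangular matrices with nonzero diagonal *)

Section TrigMatrix.
Variables (C : fieldType) (n : nat).
Implicit Types M N : 'M[C]_n.

(** Over a field these are the invertible lower triangular matrices. The class is closed under
    products, so (i) and (ii) can be checked factor by factor. *)
Definition trig_unit M := is_trig_mx M && [forall x, M x x != 0].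

Lemma trig_unitM M N : trig_unit M -> trig_unit N -> trig_unit (M *m N).
Proof.
case/andP=> /is_trig_mxP M0 /forallP Mx /andP[/is_trig_mxP N0 /forallP Nx].
apply/andP; split.
  apply/is_trig_mxP => x y ltxy; rewrite mxE big1 // => z _.
  have [/M0-> | lezx] := ltnP x z; first by rewrite mul0r.
  by rewrite N0 ?mulr0 // (leq_ltn_trans lezx).
apply/forallP => x; rewrite mxE (bigD1 x) //= big1 ?addr0 ?mulf_neq0 // => z.
rewrite neq_ltn => /orP[ltzx | /M0->]; last by rewrite mul0r.
by rewrite N0 ?mulr0.
Qed.

Lemma trig_unit_diag (d : 'rV[C]_n) :
  (forall x, d 0 x != 0) -> trig_unit (diag_mx d).
Proof.
move=> d0; rewrite /trig_unit is_diag_mx_is_trig ?diag_mx_is_diag //=.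
by apply/forallP => x; rewrite mxE eqxx mulr1n d0.
Qed.

Lemma trig_unit1 : trig_unit 1%:M.
Proof. by rewrite -diag_const_mx; apply: trig_unit_diag => x; rewrite mxE oner_eq0. Qed.

Lemma trig_unit_unitmx M : trig_unit M -> M \in unitmx.
Proof.
case/andP=> Mtrig /forallP Mx; rewrite unitmxE det_trig // unitfE.
by apply/prodf_neq0 => x _; apply: Mx.
Qed.

End TrigMatrix.

(** * Triangularity and invertibility of F *)

Section Triangular.
Variables (C : fieldType) (Lam : Type) (W : weights C Lam).
Variables (L : nat) (xi : 'I_L -> Lam) (sqrt_a : 'I_L -> 'I_L -> C).
Implicit Types (i j k : 'I_L) (w : seq 'I_L) (x y z : 'I_(2 ^ L)).
Local Notation R := (Rop W xi).
Local Notation Rrow := (Rrow W xi).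

Lemma R_neq0 i j x y : R i j x y != 0 ->
  agree [predC pred2 i j] x y.
Proof. by rewrite RopE; case: agree => //; rewrite mulr0n eqxx. Qed.

(** The R-matrix conserves the number of e_2: when site [i] loses one, site [j] gains it. *)
Lemma R_neq0_10 i j x y : R i j x y != 0 -> digit x i = 0 -> digit y i = 1 ->
  digit x j = 1 /\ digit y j = 0.
Proof.
rewrite RopE => Rxy xi0 yi1; move: Rxy; rewrite xi0 yi1.
have [->|->] := digit_eq0or1 (digit x j);
have [->|->] := digit_eq0or1 (digit y j);
by rewrite ?Rmatrix00 ?Rmatrix01 //= mul0rn eqxx.
Qed.

Lemma R_neq0_11 i j x y : R i j x y != 0 -> digit x i = 1 -> digit y i = 1 ->
  x = y.
Proof.
move=> Rxy xi1 yi1; apply/eqP; rewrite (eq_agree2 i j) R_neq0 // xi1 yi1 /=.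
move: Rxy; rewrite RopE xi1 yi1.
have [->|->] := digit_eq0or1 (digit x j);
have [->|->] := digit_eq0or1 (digit y j);
by rewrite ?Rmatrix10 ?Rmatrix11 //= ?mulr0 mul0rn eqxx.
Qed.

Lemma Rrow_neq0 i w x y : Rrow i w x y != 0 ->
  agree [predC i :: w] x y.
Proof.
elim: w x y => [|j w IH] x y.
  rewrite mxE; case: (x =P y) => [-> _|_]; [exact/agreeP | by rewrite eqxx].
rewrite RrowE mxE; apply: contraNT => nag.
rewrite big1 // => z _; apply/eqP; rewrite mulf_eq0 -[_ || _]negbK negb_or.
apply: contra nag => /andP[/IH/agreeP xz /R_neq0/agreeP zy].
apply/agreeP => k; rewrite !inE !negb_or => /and3P[ki kj kw].
by rewrite xz ?zy // !inE ?negb_or ?ki.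
Qed.

Local Notation ltI := [rel j k : 'I_L | (j < k)%N].

Lemma path_ltI_notin i w k : path ltI i w -> (k <= i)%N -> k \notin w.
Proof.
move=> iw leki; apply/negP => kw.
have ltI_trans : transitive ltI by move=> ? ? ? /=; apply: ltn_trans.
have /allP/(_ _ kw) /= := order_path_min ltI_trans iw.
by rewrite ltnNge leki.
Qed.

Lemma path_ltI_tail i j w : path ltI i (j :: w) -> path ltI i w.
Proof.
have ltI_trans : transitive ltI by move=> ? ? ? /=; apply: ltn_trans.
by rewrite !(path_sortedE ltI_trans) /= => /andP[/andP[_ ->] /path_sorted].
Qed.

Lemma Rrow_trig i w x y : path ltI i w -> digit x i = 1 ->
  Rrow i w x y != 0 -> (y <= x)%N.
Proof.
elim: w y => [|j w IH] y iw xi1.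
  by rewrite mxE; case: (x =P y) => [->|_] //; rewrite eqxx.
(* If [y] has e_1 at [i], then [i] is the first site where [x] and [y] differ, since [w] lies to its
   right. *)
move=> nz; have [yi0|yi1] := digit_eq0or1 (digit y i).
  apply/ltnW/(ltn_digit _ yi0 xi1) => l ltli; have /agreeP-> // := Rrow_neq0 nz.
  rewrite inE /= in_cons negb_or neq_ltn ltli.
  exact: path_ltI_notin iw (ltnW ltli).
move: (nz); rewrite RrowE mxE; apply: contraNT => nle.
rewrite big1 // => z _; apply/eqP; move: nle; apply: contraNT.
rewrite mulf_eq0 negb_or => /andP[xz zy].
(* Either [R i j] leaves the auxiliary site in e_2, so that [z = y] and induction applies, or it
   turns it into e_1 at [j]. *)
have [zi0|zi1] := digit_eq0or1 (digit z i); last first.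
  by move: xz; rewrite (R_neq0_11 zy zi1 yi1); apply: IH => //; apply: path_ltI_tail iw.
have [zj1 yj0] := R_neq0_10 zy zi0 yi1.
have /andP[ltij jw] : (i < j)%N && path ltI j w := iw.
(* The rest of the row does not act on [j], so [x] keeps the e_2 of [z] there and [j] is the first
   site where [x] and [y] differ. *)
have xj1 : digit x j = 1.
  rewrite -zj1; have /agreeP-> // := Rrow_neq0 xz.
  by rewrite !inE negb_or neq_ltn ltij orbT (path_ltI_notin jw).
apply/ltnW/(ltn_digit _ yj0 xj1) => l ltlj.
have [->|neli] := eqVneq l i; first by rewrite xi1.
apply/esym; have /agreeP-> // := Rrow_neq0 nz.
rewrite !inE !negb_or neli (neq_ltn l j) ltlj /=.
exact: path_ltI_notin jw (ltnW ltlj).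
Qed.

Hypothesis a_neq0 : forall i j, i != j -> a_minus W (xi i) (xi j) != 0.
Hypothesis b_neq0 : forall i j, i != j -> b_minus W (xi i) (xi j) != 0.

Lemma R_diag_neq0 i j x : i != j -> digit x i = 1 -> R i j x x != 0.
Proof.
move=> neij xi1; rewrite RopE xi1.
have -> : agree [predC pred2 i j] x x by apply/agreeP.
have [->|->] := digit_eq0or1 (digit x j).
  by rewrite Rmatrix10 /= b_neq0.
by rewrite Rmatrix11 /= mulr1 a_neq0.
Qed.

(** Only the intermediate index [z = x] contributes, so the diagonal entry is a product of diagonal
    entries of the R-matrices. Any other [z] has changed the digit at [j], which the later factors
    cannot restore. *)
Lemma Rrow_diag_neq0 i w x : path ltI i w -> digit x i = 1 ->
  Rrow i w x x != 0.
Proof.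
elim: w => [|j w IH] iw xi1; first by rewrite mxE eqxx oner_eq0.
have /andP[ltij jw] : (i < j)%N && path ltI j w := iw.
have neij : i != j by rewrite neq_ltn ltij.
rewrite RrowE mxE (bigD1 x) //= big1 ?addr0 => [|z nezx].
  by rewrite mulf_neq0 ?R_diag_neq0 ?IH //; apply: path_ltI_tail iw.
apply/eqP; move: nezx; apply: contraNT; rewrite mulf_eq0 negb_or.
case/andP=> xz zx; apply/eqP.
have [zi0|zi1] := digit_eq0or1 (digit z i); last exact: R_neq0_11 zx zi1 xi1.
have [zj1 xj0] := R_neq0_10 zx zi0 xi1.
have /agreeP/(_ j) := Rrow_neq0 xz; rewrite xj0 zj1 => /(_ _)/esym/eqP.
by rewrite !inE negb_or eq_sym neij (path_ltI_notin jw) // => /(_ isT).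
Qed.

(** The rows with e_1 at [i] are those of the identity, the others those of [Rrow i w]. *)
Lemma calF_row_trig_unit i w : path ltI i w -> trig_unit (calF_row W xi i w).
Proof.
move=> iw; have FE x y : calF_row W xi i w x y =
    (digit x i == 0)%:R *+ (x == y) + (digit x i == 1)%:R * Rrow i w x y.
  by rewrite calF_rowE mxE projE projM.
apply/andP; split.
  apply/is_trig_mxP => x y ltxy; rewrite FE.
  have -> : (x == y) = false by apply/negbTE; rewrite neq_ltn ltxy.
  have [->|xi1] := digit_eq0or1 (digit x i); first by rewrite mul0r add0r.
  rewrite xi1 mul1r add0r; apply/eqP; move: ltxy; apply: contraTT.
  by rewrite -leqNgt; apply: Rrow_trig.
apply/forallP => x; rewrite FE eqxx.
have [->|xi1] := digit_eq0or1 (digit x i); first by rewrite mul0r addr0 oner_eq0.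
by rewrite xi1 mul1r add0r Rrow_diag_neq0.
Qed.

Lemma calF_trig_unit w : sorted ltI w -> trig_unit (calF W xi w).
Proof.
elim: w => [_|i w IH iw]; first exact: trig_unit1.
rewrite calF_cons; apply: trig_unitM; last exact: calF_row_trig_unit.
exact/IH/(path_sorted iw).
Qed.

Hypothesis s_neq0 : forall i j, i != j -> sqrt_a i j != 0.

Lemma calN2_trig_unit i j : i != j -> trig_unit (calN2 sqrt_a i j).
Proof.
move=> neij.
have -> : calN2 sqrt_a i j = diag_mx (\row_x
    if (digit x i == 1) && (digit x j == 1) then (sqrt_a i j)^-1 else 1).
  apply/matrixP => x y; rewrite calN2E.
  have one : (1 : 'M[C]_(2 ^ L)) x y = (x == y)%:R by rewrite mxE.
  rewrite [LHS]mxE one [X in _ + X]mxE projM projE [RHS]mxE mxE.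
  case: (x == y); case: (digit x i == 1); case: (digit x j == 1);
  by rewrite /= ?mulr0n ?mulr1n ?mul0r ?mulr0 ?mul1r ?mulr1 ?addr0 // addrC subrK.
apply: trig_unit_diag => x; rewrite mxE; case: ifP => _; last exact: oner_neq0.
by rewrite invr_eq0 s_neq0.
Qed.

Lemma calN_trig_unit w : uniq w -> trig_unit (calN sqrt_a w).
Proof.
elim: w => [_|i w IH]; first exact: trig_unit1.
rewrite cons_uniq => /andP[iw uw]; rewrite calN_cons.
apply: trig_unitM; last exact: IH.
rewrite big_seq; apply: (big_ind (@trig_unit C (2 ^ L))).
- exact: trig_unit1.
- exact: trig_unitM.
- by move=> j jw; apply: calN2_trig_unit; apply: contraNneq iw => ->.
Qed.

(** The order of the labels matters here: [id_word L] is increasing, so each row operator acts only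
    on sites to the right of its auxiliary site. *)
Lemma Fmatrix_trig_unit : trig_unit (Fmatrix W xi sqrt_a (id_word L)).
Proof.
apply: trig_unitM; first exact/calN_trig_unit/enum_uniq.
apply: calF_trig_unit; have := iota_ltn_sorted 0 L.
by rewrite -val_enum_ord sorted_map.
Qed.

End Triangular.

Local Open Scope complex_scope.

Theorem mainTheorem1 (K : realType) (Lam : Type) (W : weights K[i] Lam)
    (hU : unitarity W) (hYB : yang_baxter W)
    (L : nat) (hL : (2 <= L)%N) (xi : 'I_L -> Lam)
    (sqrt_a : 'I_L -> 'I_L -> K[i])
    (hsqrt : forall i j, i != j -> sqrt_a i j ^+ 2 = a_minus W (xi i) (xi j))
    (hsqrtV : forall i j, i != j -> sqrt_a i j * sqrt_a j i = 1)
    (hb : forall i j, i != j -> b_minus W (xi i) (xi j) != 0) :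
  let F := Fmatrix W xi sqrt_a in
  [/\ is_trig_mx (F (id_word L)),
      F (id_word L) \in unitmx
    & forall (s : 'S_L) (Rs : 'M[K[i]]_(2 ^ L)),
        permuted_R W xi (perm_word s) Rs ->
        F (perm_word s) *m Rs = F (id_word L)].
Proof.
have s_neq0 i j : i != j -> sqrt_a i j != 0.
  by move/hsqrtV; apply: contra_eq_neq => ->; rewrite mul0r eq_sym oner_eq0.
(* [a_minus] is the square of a root that [hsqrtV] makes invertible. *)
have a_neq0 i j : i != j -> a_minus W (xi i) (xi j) != 0.
  by move=> neij; rewrite -hsqrt // expf_neq0 ?s_neq0.
have F_trig := Fmatrix_trig_unit a_neq0 hb s_neq0.
split; first by case/andP: F_trig.
  exact: trig_unit_unitmx F_trig.
by move=> s Rs; apply: Fmatrix_permuted_R.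
Qed.
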